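(* Let $\mathsf{e},\mathsf{f}$ be elements of the monoid $\mathbf{O}_N$ of rank $N$ Okada arc-diagrams, with left halves $|\mathsf{e}\rangle$ and $|\mathsf{f}\rangle$. Then $\mathsf{e}\le_{\mathcal{R}}\mathsf{f}$ if and only if $|\mathsf{e}\rangle\trianglelefteq|\mathsf{f}\rangle$.
   Context: Okada arc-diagrams. Let $[N]=\{1,\dots,N\}$, $\overline{[N]}=\{\bar1,\dots,\bar N\}$, $|i|=|\bar i|=i$, ordered by $1<\dots<N<\bar N<\dots<\bar1$. A non-crossing arc-diagram of rank $N$ is a perfect matching of $[N]\cup\overline{[N]}$ (pairs are arcs) with no arcs $\{a,b\},\{c,d\}$ with $a<c<b<d$. Arc $\{a<b\}$ is nested in $\{c<d\}$ if $c<a<b<d$. An Okada arc-diagram is a non-crossing arc-diagram with integer labels on arcs such that the label of $\{a,b\}$ is at least $1$, at most $\min(|a|,|b|)$ and of the same parity as $\min(|a|,|b|)$, and an arc nested in another has a strictly larger label. Product: identify each node $\bar i$ of the left factor with node $i$ of the right factor, concatenate arcs, discard closed loops, and label each resulting arc by the minimum of the labels of the arcs composing it. This makes rank $N$ Okada arc-diagrams a monoid (identity: arcs $\{a,\bar a\}$ labelled $a$), isomorphic to and identified with the Okada monoid $\mathbf{O}_N$. The left half $|D\rangle$ of an Okada arc-diagram $D$ is the half diagram on nodes $[N]$ consisting of the arcs of $D$ joining two nodes of $[N]$ (full arcs, with their labels) together with, for each arc of $D$ joining $i\in[N]$ to $\overline{[N]}$, a propagating half arc at $i$ with the same label. The relation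 $G\trianglelefteq H$ between half diagrams means: (1) whenever $\{i,j\}$ labelled $\ell$ is a full arc of $H$, it is a full arc of $G$ with the same label; (2) whenever $H$ has a propagating half arc at $i$ labelled $\ell$, the arc of $G$ incident to $i$ (propagating or not) has label at most $\ell$. Green's $\mathcal{R}$-preorder on a monoid $M$: $x\le_{\mathcal{R}}y$ if $x=yu$ for some $u\in M$. *)

(* Defs.v *)
From HB Require Import structures.
From mathcomp Require Import all_boot.

Set Implicit Arguments.
Unset Strict Implicit.
Unset Printing Implicit Defensive.

(* [inl i] is the node i+1 of [N]; [inr i] is the barred node with the same
   absolute value i+1. *)
Definition node (N : nat) := ('I_N + 'I_N)%type.

Definition nabs (N : nat) (x : node N) : nat :=
  match x with inl i => i.+1 | inr i => i.+1 end.

(* Rank of a node in the order 1 < ... < N < bar N < ... < bar 1. *)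
Definition pos (N : nat) (x : node N) : nat :=
  match x with inl i => i.+1 | inr i => N.*2 - i end.

Definition node_lt (N : nat) (x y : node N) : bool := pos x < pos y.

(* A matching is given by the map sending each node to the other end of its arc,
   and a labelling of the arcs by a map on nodes giving the label of the arc
   incident to the node. *)
Record diagram (N : nat) := Diagram {
  mate : {ffun node N -> node N};
  lab : {ffun node N -> nat} }.

Section OkadaPredicates.
Variables (N : nat) (D : diagram N).

Definition perfect_matching : bool :=
  [forall x, (mate D x != x) && (mate D (mate D x) == x)].

Definition noncrossing : bool :=
  [forall a, forall c,
    ~~ [&& node_lt a c, node_lt c (mate D a) & node_lt (mate D a) (mate D c)]].

(* The arc at [a] is {a < mate a} and is nested in {c < mate c}. *)
Definition nested (a c : node N) : bool :=
  [&& node_lt c a, node_lt a (mate D a) & node_lt (mate D a) (mate D c)].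

Definition okada_labelling : bool :=
  [&& [forall a, lab D (mate D a) == lab D a],
      [forall a, let m := minn (nabs a) (nabs (mate D a)) in
         [&& 1 <= lab D a, lab D a <= m & odd (lab D a) == odd m]]
    & [forall a, forall c, nested a c ==> (lab D c < lab D a)]].

Definition is_okada : bool :=
  [&& perfect_matching, noncrossing & okada_labelling].

End OkadaPredicates.

Record okada (N : nat) := Okada {
  okada_diagram :> diagram N;
  okadaP : is_okada okada_diagram }.

HB.instance Definition _ (N : nat) := [isSub for @okada_diagram N].

Section Product.
Variables (N : nat) (D E : diagram N).

(* Vertices of the concatenation: the nodes of D (left) and of E (right); the
   identification of bar i in D with i in E is an additional edge. *)
Definition concat_edge (v w : node N + node N) : bool :=
  match v, w with
  | inl x, inl y => mate D x == y
  | inr x, inr y => mate E x == y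
  | inl (inr i), inr (inl j) => i == j
  | inr (inl j), inl (inr i) => i == j
  | _, _ => false
  end.

(* The node of the concatenation from which a node of the product comes. *)
Definition outer (x : node N) : node N + node N :=
  match x with inl i => inl (inl i) | inr i => inr (inr i) end.

Definition concat_lab (v : node N + node N) : nat :=
  match v with inl x => lab D x | inr x => lab E x end.

(* The connected component of an outer node is a path whose other end is the
   unique other outer node in it, so that the default [x] is never used on
   perfect matchings. Closed loops are the components without outer node. *)
Definition diagram_mul : diagram N :=
  Diagram
    [ffun x => odflt x
       [pick y | (y != x) && connect concat_edge (outer x) (outer y)]]
    [ffun x => \big[minn/concat_lab (outer x)]_(
       v | connect concat_edge (outer x) v) concat_lab v].

End Product.

(* Green's R-preorder on the Okada monoid; the product of two Okada diagrams is
   compared with [x] as a diagram. *)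
Definition okada_leR (N : nat) (x y : okada N) : Prop :=
  exists u : okada N, x = diagram_mul y u :> diagram N.

(* [hmate i] is [Some j] for a full arc {i, j}, [None] for a propagating half
   arc at i. *)
Record half_diagram (N : nat) := HalfDiagram {
  hmate : {ffun 'I_N -> option 'I_N};
  hlab : {ffun 'I_N -> nat} }.

Definition left_half (N : nat) (D : diagram N) : half_diagram N :=
  HalfDiagram
    [ffun i => if mate D (inl i) is inl j then Some j else None]
    [ffun i => lab D (inl i)].

Definition half_le (N : nat) (G H : half_diagram N) : Prop :=
  (forall i j : 'I_N, hmate H i = Some j ->
     hmate G i = Some j /\ hlab G i = hlab H i) /\
  (forall i : 'I_N, hmate H i = None -> hlab G i <= hlab H i).

(* Main.v *)
Require Import Defs.
From mathcomp Require Import all_boot zify.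

(** Left to right: in a product [f u] a full arc of the left half of [f] is a
    whole component of the concatenation, so it survives with its label
    ([mul_left_arc]); at any other left node the label is a minimum of labels
    one of which is that of [f].

    Right to left: let [f^*] be the mirror image of [f]. When the left half of
    [e] is below that of [f] one has [f f^* e = e], so [u = f^* e] is a
    solution. Indeed [f f^*] consists of the full left arcs of [f], of their
    mirror images, and of an arc from [i] to [bar i], labelled as in [f], for
    each [i] where [f] propagates. Multiplying [e] by it on the left leaves the
    full arcs of [f], which are already in [e], and caps the labels of the other
    arcs of [e] by labels of [f] which by assumption are at least as large.

    Instead of proving that products of Okada diagrams are Okada diagrams and
    that the product is associative, the proof writes [f^* e] down
    ([cofactor]). An arc of [f] joining [i] to [bar p] moves the left node [i]
    of [e] to [p] ([slide]), and the remaining left nodes carry the mirror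
    images of the full right arcs of [f]. Moving nodes preserves their order,
    because propagating arcs do not cross ([slide_mono]), and the parity of
    their absolute values, because an even number of nodes lies on either side
    of an arc ([through_parity]); with the comparison of labels this makes
    [cofactor] an Okada diagram ([cofactor_okada]). In the concatenation of [f]
    with it, the components of outer nodes are paths of at most six vertices,
    which are followed one by one ([diagram_mul_arc], [mul_cofactor]). *)

(** * Okada arc-diagrams as matchings of nodes *)

Section OkadaFacts.

Variables (N : nat) (D : okada N).

Lemma mateK x : mate D (mate D x) = x.
Proof.
by case/and3P: (okadaP D) => /forallP/(_ x)/andP[_ /eqP].
Qed.

Lemma mate_neq x : mate D x != x.
Proof. by case/and3P: (okadaP D) => /forallP/(_ x)/andP[]. Qed.

Lemma mate_sym x y : mate D x = y -> mate D y = x.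
Proof. by move=> <-; rewrite mateK. Qed.

Lemma mate_noncrossing a c :
  pos a < pos c -> pos c < pos (mate D a) ->
  pos (mate D a) < pos (mate D c) -> False.
Proof.
move=> ac cb bd; case/and3P: (okadaP D) => _ /forallP/(_ a)/forallP/(_ c).
by rewrite /node_lt ac cb bd.
Qed.

Lemma lab_mate x : lab D (mate D x) = lab D x.
Proof.
by case/and3P: (okadaP D) => _ _ /and3P[/forallP/(_ x)/eqP].
Qed.

Lemma lab_bounds x :
  [/\ 1 <= lab D x, lab D x <= nabs x, lab D x <= nabs (mate D x)
    & odd (lab D x) = odd (minn (nabs x) (nabs (mate D x)))].
Proof.
case/and3P: (okadaP D) => _ _ /and3P[_ /forallP/(_ x)/= /and3P[h1 h2 /eqP h3] _].
by split=> //; lia.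
Qed.

Lemma lab_nested a c :
  pos c < pos a -> pos a < pos (mate D a) -> pos (mate D a) < pos (mate D c) ->
  lab D c < lab D a.
Proof.
move=> ca ab bd.
case/and3P: (okadaP D) => _ _ /and3P[_ _ /forallP/(_ a)/forallP/(_ c)/implyP].
by apply; rewrite /nested /node_lt ca ab bd.
Qed.

End OkadaFacts.

Lemma pos_inj N : injective (@pos N).
Proof.
move=> [i|i] [j|j] /= ij; have := ltn_ord i; have := ltn_ord j => jN iN.
- by congr inl; apply/val_inj => /=; lia.
- lia.
- lia.
- by congr inr; apply/val_inj => /=; lia.
Qed.

Lemma involution_even (T : finType) (m : T -> T) (A : {set T}) :
  involutive m -> (forall x, m x != x) -> (forall x, x \in A -> m x \in A) ->
  ~~ odd #|A|.
Proof.
move=> mK m_neq; have [n] := ubnP #|A|; elim: n A => // n IHn A.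
have [->|[x Ax]] := set_0Vmem A; first by rewrite cards0.
rewrite (cardsD1 x) Ax (cardsD1 (m x)) => An Am.
rewrite in_setD1 m_neq (Am x Ax) /= negbK; apply: IHn.
  by move: An; rewrite in_setD1 m_neq (Am x Ax); lia.
move=> y; rewrite !in_setD1 => /and3P[ymx yx Ay].
by rewrite (inj_eq (can_inj mK)) yx (can2_eq mK mK) ymx Am.
Qed.

Lemma card_ord_lt (N i : nat) : i <= N -> #|[set k : 'I_N | k < i]| = i.
Proof.
move=> iN; rewrite -sum1dep_card.
by rewrite -(big_ord_widen N (fun=> 1) iN) sum1_card card_ord.
Qed.

(** The [i] left and [j] right nodes outside the arc from [i] to [bar j] are
    matched among themselves, since the arc is not crossed; so [i + j] is
    even. *)
Lemma through_parity N (D : okada N) (i j : 'I_N) :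
  mate D (inl i) = inr j -> odd i = odd j.
Proof.
move=> Dij; have Dji := mate_sym _ _ _ _ Dij.
pose A := [set x : node N | (pos x < pos (inl i : node N)) ||
                            (pos (inr j : node N) < pos x)].
have cA : #|A| = i + j.
  rewrite -sum1_card big_sumType /=.
  have iN := ltn_ord i; have jN := ltn_ord j.
  rewrite -[in RHS](card_ord_lt _ _ (ltnW iN)) -[in RHS](card_ord_lt _ _ (ltnW jN)).
  rewrite -!sum1_card.
  by congr (_ + _); apply: eq_bigl => k; rewrite !inE /=; have := ltn_ord k; lia.
suff: ~~ odd #|A| by rewrite cA oddD; case: (odd i); case: (odd j).
apply: (@involution_even _ (mate D)); [exact: mateK | exact: mate_neq |].
move=> x; rewrite !inE => Ax; apply/negPn/negP; rewrite negb_or -!leqNgt => /andP[lo hi].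
(* If an outside node had its mate inside, the arc between them would cross the
   given arc. *)
have ni : mate D x != inl i.
  apply/eqP=> E; move: Ax; rewrite -(mateK _ D x) E Dij ltnn orbF /=.
  by have := ltn_ord i; have := ltn_ord j; lia.
have nj : mate D x != inr j.
  apply/eqP=> E; move: Ax; rewrite -(mateK _ D x) E Dji ltnn /=.
  by have := ltn_ord i; have := ltn_ord j; lia.
have {}lo : pos (inl i : node N) < pos (mate D x).
  by rewrite ltn_neqAle lo andbT; apply: contra ni => /eqP/pos_inj ->.
have {}hi : pos (mate D x) < pos (inr j : node N).
  by rewrite ltn_neqAle hi andbT; apply: contra nj => /eqP/pos_inj ->.
case/orP: Ax => Ax.
  by apply: (mate_noncrossing _ D x (inl i)); rewrite ?Dij.
by apply: (mate_noncrossing _ D (inl i) (mate D x)); rewrite ?Dij ?mateK.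
Qed.

(** * Paths in the concatenation of two diagrams *)

(** [minn] has no neutral element, so the default [d] takes part in the minimum
    and has to be bounded as well. *)
Lemma bigmin_eq (I : finType) (P : pred I) (F : I -> nat) (d m : nat) :
  m <= d -> (forall v, P v -> m <= F v) -> (exists2 v, P v & F v = m) ->
  \big[minn/d]_(v | P v) F v = m.
Proof.
move=> md mF [v Pv Fv]; apply/eqP; rewrite eqn_leq; apply/andP; split.
  rewrite -Fv; have: v \in index_enum I by rewrite mem_index_enum.
  elim: (index_enum I) => //= w s IHs; rewrite inE big_cons => /predU1P[<-|vs].
    by rewrite Pv geq_minl.
  by case: ifP => _; rewrite ?geq_min IHs ?orbT.
by elim/big_ind: _ => // x y mx my; rewrite leq_min mx my.
Qed.

Lemma bigmin_le_idx (I : finType) (P : pred I) (F : I -> nat) (d : nat) :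
  \big[minn/d]_(v | P v) F v <= d.
Proof. by elim/big_rec: _ => // v x _ xd; rewrite geq_min xd orbT. Qed.

Definition is_arc N (D : diagram N) (x y : node N) (m : nat) :=
  [/\ mate D x = y, mate D y = x, lab D x = m & lab D y = m].

Lemma is_arcC N (D : diagram N) x y m : is_arc N D x y m -> is_arc N D y x m.
Proof. by case. Qed.

Lemma concat_edge_sym N (D E : okada N) : symmetric (concat_edge D E).
Proof.
have msym (C : okada N) x y : (mate C x == y) = (mate C y == x).
  by apply/eqP/eqP; apply: mate_sym.
by move=> [[i|i]|[i|i]] [[j|j]|[j|j]] //=; rewrite 1?msym // eq_sym.
Qed.

(** The interface to the product: a path [c] between two outer nodes that no
    edge leaves and that meets no third outer node is their whole connected
    component, hence determines an arc of the product and its label. *)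
Lemma diagram_mul_arc N (D E : okada N) x y (s : seq (node N + node N)) m :
  let c := outer x :: s in
  path (concat_edge D E) (outer x) s -> last (outer x) s = outer y -> x != y ->
  {in c, forall v w, concat_edge D E v w -> w \in c} ->
  (forall z, outer z \in c -> z = x \/ z = y) ->
  all (fun v => m <= concat_lab D E v) c ->
  has (fun v => concat_lab D E v == m) c ->
  is_arc N (diagram_mul D E) x y m.
Proof.
move=> c path_s last_s xy closed_c outer_c /allP min_c has_c.
have symE : connect_sym (concat_edge D E) by apply/sym_connect_sym/concat_edge_sym.
have yc : outer y \in c by rewrite -last_s mem_last.
have conn_x v : connect (concat_edge D E) (outer x) v = (v \in c).
  apply/idP/idP => [xv|]; last exact: path_connect path_s v.
  have cl : closed (concat_edge D E) (mem c).
    by apply: intro_closed => // u w uw uc; apply: closed_c uw.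
  by rewrite -(closed_connect cl xv) mem_head.
have conn_y v : connect (concat_edge D E) (outer y) v = (v \in c).
  by rewrite -conn_x; apply/esym/(same_connect symE); rewrite conn_x.
have core a b : (forall v, connect (concat_edge D E) (outer a) v = (v \in c)) ->
    a != b -> outer a \in c -> outer b \in c ->
    (forall z, outer z \in c -> z = a \/ z = b) ->
    mate (diagram_mul D E) a = b /\ lab (diagram_mul D E) a = m.
  move=> conn_a ab ac bc outer_ab; rewrite !ffunE; split.
    case: pickP => [z /andP[za]|/(_ b)].
      by rewrite conn_a => /outer_ab[] // E1; rewrite E1 eqxx in za.
    by rewrite conn_a bc eq_sym ab.
  apply: bigmin_eq => [|v|]; first exact: min_c.
    by rewrite conn_a => /min_c.
  by case/hasP: has_c => v vc /eqP Fv; exists v; rewrite ?conn_a.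
have [mx lx] := core x y conn_x xy (mem_head _ _) yc outer_c.
have outer_cC z : outer z \in c -> z = y \/ z = x by case/outer_c; [right|left].
rewrite eq_sym in xy.
by have [my ly] := core y x conn_y xy yc (mem_head _ _) outer_cC.
Qed.

(** Checks that no edge leaves an explicit list of vertices, by rewriting with
    the equations in the context that give the mates of these vertices. *)
Ltac close_component :=
  let v := fresh "v" in let w := fresh "w" in
  move=> v + w; rewrite !inE;
  repeat case/orP; move=> /eqP ->; case: w => [[w|w]|[w|w]] //=;
  repeat match goal with H : _ = _ |- _ => rewrite H end;
  move=> /eqP; try (by []); first
    [by case=> ->; rewrite eqxx ?orbT | by move=> ->; rewrite eqxx ?orbT].

Lemma mul_left_arc N (D E : okada N) i j :
  mate D (inl i) = inl j ->
  is_arc N (diagram_mul D E) (inl i) (inl j) (lab D (inl i)).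
Proof.
move=> Dij; have Dji := mate_sym _ _ _ _ Dij.
apply: (diagram_mul_arc _ _ _ _ _ [:: inl (inl j)]) => //=.
- by rewrite Dij eqxx.
- by rewrite -Dij eq_sym mate_neq.
- by close_component.
- by move=> [k|k]; rewrite !inE //= => /orP[] /eqP[->]; [left|right].
- by rewrite -Dij lab_mate leqnn.
- by rewrite eqxx.
Qed.

Lemma mul_right_arc N (D E : okada N) i j :
  mate E (inr i) = inr j ->
  is_arc N (diagram_mul D E) (inr i) (inr j) (lab E (inr i)).
Proof.
move=> Eij; have Eji := mate_sym _ _ _ _ Eij.
apply: (diagram_mul_arc _ _ _ _ _ [:: inr (inr j)]) => //=.
- by rewrite Eij eqxx.
- by rewrite -Eij eq_sym mate_neq.
- by close_component.
- by move=> [k|k]; rewrite !inE //= => /orP[] /eqP[->]; [left|right].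
- by rewrite -Eij lab_mate leqnn.
- by rewrite eqxx.
Qed.

Lemma mul_through_arc N (D E : okada N) i p j :
  mate D (inl i) = inr p -> mate E (inl p) = inr j ->
  lab E (inl p) <= lab D (inl i) ->
  is_arc N (diagram_mul D E) (inl i) (inr j) (lab E (inl p)).
Proof.
move=> Dip Epj lED; have Dpi := mate_sym _ _ _ _ Dip; have Ejp := mate_sym _ _ _ _ Epj.
have lD : lab D (inr p) = lab D (inl i) by rewrite -Dip lab_mate.
have lE : lab E (inr j) = lab E (inl p) by rewrite -Epj lab_mate.
apply: (diagram_mul_arc _ _ _ _ _ [:: inl (inr p); inr (inl p); inr (inr j)]) => //=.
- by rewrite Dip Epj !eqxx.
- by close_component.
- by move=> [k|k]; rewrite !inE //= ?orbF => /eqP[->]; [left|right].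
- by rewrite lD lE lED leqnn.
- by rewrite eqxx !orbT.
Qed.

(** An arc of [E] with both ends on the left becomes a left arc of the product:
    the path enters [E] through [D], and comes back through [D]. *)
Lemma mul_turn_back_arc N (D E : okada N) i p q j :
  mate D (inl i) = inr p -> mate E (inl p) = inl q -> mate D (inl j) = inr q ->
  lab E (inl p) <= lab D (inl i) -> lab E (inl p) <= lab D (inl j) ->
  is_arc N (diagram_mul D E) (inl i) (inl j) (lab E (inl p)).
Proof.
move=> Dip Epq Djq lEi lEj.
have Dpi := mate_sym _ _ _ _ Dip; have Dqj := mate_sym _ _ _ _ Djq.
have Eqp := mate_sym _ _ _ _ Epq.
have lp : lab D (inr p) = lab D (inl i) by rewrite -Dip lab_mate.
have lq : lab D (inr q) = lab D (inl j) by rewrite -Djq lab_mate.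
have lE : lab E (inl q) = lab E (inl p) by rewrite -Epq lab_mate.
apply: (diagram_mul_arc _ _ _ _ _
  [:: inl (inr p); inr (inl p); inr (inl q); inl (inr q); inl (inl j)]) => //=.
- by rewrite Dip Epq Dqj !eqxx.
- apply/eqP=> -[ij]; have := mate_neq _ E (inl p).
  by rewrite Epq; move: Djq; rewrite -ij Dip => -[->]; rewrite eqxx.
- by close_component.
- by move=> [k|k]; rewrite !inE //= => /orP[] /eqP[->]; [left|right].
- by rewrite lp lq lE lEi lEj leqnn.
- by rewrite eqxx !orbT.
Qed.

(** * The cofactor of a diagram along a larger left half *)

Section Cofactor.

Variables (N : nat) (e f : okada N).

Hypothesis keep_arc : forall i j, mate f (inl i) = inl j ->
  mate e (inl i) = inl j /\ lab e (inl i) = lab f (inl i).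
Hypothesis lab_le : forall i p, mate f (inl i) = inr p ->
  lab e (inl i) <= lab f (inl i).

(** The position in [f^* e] of a left node of [e], found by following the
    propagating arc of [f]. The value at an end of a full arc of [f] is junk. *)
Definition slide (z : node N) : node N :=
  if z is inl i then if mate f (inl i) is inr p then inl p else z else z.

(** The nodes of [e] that lie on none of the full left arcs of [f]. *)
Definition free (z : node N) : bool :=
  if z is inl i then if mate f (inl i) is inr _ then true else false else true.

(** The product of the mirror image of [f] with [e]. *)
Definition cofactor : diagram N := Diagram
  [ffun x => match x with
    | inl p => match mate f (inr p) with
               | inl i => slide (mate e (inl i))
               | inr q => inl q
               end
    | inr j => slide (mate e (inr j))
    end]
  [ffun x => match x with
    | inl p => match mate f (inr p) with
               | inl i => lab e (inl i)
               | inr _ => lab f (inr p)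
               end
    | inr j => lab e (inr j)
    end].

(** The full left arcs of [f] are arcs of [e], so the other arcs of [e] avoid
    their ends. *)
Lemma free_mate z : free z -> free (mate e z).
Proof.
case E: (mate e z) => [j|//] /=; case F: (mate f (inl j)) => [k|//] fz.
have [Ejk _] := keep_arc _ _ F.
move: fz; have -> : z = inl k by rewrite -(mateK _ e z) E.
by rewrite /= (mate_sym _ _ _ _ F).
Qed.

Lemma cofactor_slide z : free z ->
  mate cofactor (slide z) = slide (mate e z) /\ lab cofactor (slide z) = lab e z.
Proof.
case: z => [i|j] /=; last by rewrite !ffunE.
case F: (mate f (inl i)) => [//|p] _; rewrite !ffunE.
by rewrite (mate_sym _ _ _ _ F).
Qed.

Lemma cofactor_mirror p q : mate f (inr p) = inr q ->
  mate cofactor (inl p) = inl q /\ lab cofactor (inl p) = lab f (inr p).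
Proof. by move=> F; rewrite !ffunE F. Qed.

(** Every node of the cofactor is on an arc inherited from [e] or on the mirror
    image of a full right arc of [f]. *)
Variant node_spec : node N -> Prop :=
| SlidNode z of free z : node_spec (slide z)
| MirrorNode p q of mate f (inr p) = inr q : node_spec (inl p).

Lemma nodeP x : node_spec x.
Proof.
case: x => [p|j]; last exact: (SlidNode (inr j)).
case F: (mate f (inr p)) => [i|q]; last exact: MirrorNode F.
have F' := mate_sym _ _ _ _ F.
by have := SlidNode (inl i); rewrite /= F'; apply.
Qed.

(** On the right side the order is reversed, so that two propagating arcs which
    do not cross are nested, and their ends come in the same order of absolute
    values. *)
Lemma through_lt i j p q : mate f (inl i) = inr p -> mate f (inl j) = inr q ->
  i < j -> p < q.
Proof.
move=> Fi Fj ij; rewrite ltnNge; apply/negP=> qp.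
have iN := ltn_ord i; have jN := ltn_ord j; have pN := ltn_ord p; have qN := ltn_ord q.
have ne : p <> q :> nat.
  move=> /val_inj pq; move: Fj; rewrite -pq -Fi => /(congr1 (mate f)).
  by rewrite !mateK => -[ji]; rewrite ji ltnn in ij.
by apply: (mate_noncrossing _ f (inl i) (inl j)); rewrite ?Fi ?Fj /=; lia.
Qed.

Lemma slide_homo z w : free z -> free w ->
  pos z < pos w -> pos (slide z) < pos (slide w).
Proof.
case: z w => [i|i] [j|j] //=.
- case Fi: (mate f (inl i)) => [//|p] _; case Fj: (mate f (inl j)) => [//|q] _ /=.
  by rewrite !ltnS; apply: through_lt Fi Fj.
- case Fi: (mate f (inl i)) => [//|p] _ _ _ /=.
  by have := ltn_ord p; have := ltn_ord j; lia.
- by move=> _ _ ij; have := ltn_ord i; have := ltn_ord j; lia.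
Qed.

Lemma slide_mono z w : free z -> free w ->
  (pos (slide z) < pos (slide w)) = (pos z < pos w).
Proof.
move=> fz fw; apply/idP/idP; last exact: slide_homo.
rewrite ltnNge => h; rewrite ltnNge; apply: contra h.
rewrite leq_eqVlt => /predU1P[/pos_inj -> //|wz].
exact/ltnW/slide_homo.
Qed.

Lemma slide_inj z w : free z -> free w -> slide z = slide w -> z = w.
Proof.
move=> fz fw zw; apply: pos_inj.
have := slide_mono z w fz fw; have := slide_mono w z fw fz.
by rewrite zw ltnn; lia.
Qed.

(** The propagating arc of [f] that places [z] would cross the full arc of
    [f] whose mirror image is [{p, q}]. *)
Lemma mirror_encloses_no_slid p q z : mate f (inr p) = inr q -> free z ->
  pos (inl p : node N) < pos (slide z) -> pos (slide z) < pos (inl q : node N) -> False.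
Proof.
move=> Fpq; have Fqp := mate_sym _ _ _ _ Fpq.
have pN := ltn_ord p; have qN := ltn_ord q.
case: z => [i|j] /=; last by have := ltn_ord j; lia.
case Fi: (mate f (inl i)) => [//|r] _ /= pr rq.
have iN := ltn_ord i; have rN := ltn_ord r.
by apply: (mate_noncrossing _ f (inl i) (inr q)); rewrite ?Fi ?Fqp /=; lia.
Qed.

(** Here [{p, q}] lies to the right of [slide z], as when it is nested in an arc
    inherited from [e]. In [f] its mirror image is then nested in the
    propagating arc that places [z], whose label bounds that of [z] in [e]. *)
Lemma lab_slid_lt_mirror p q z : mate f (inr p) = inr q -> free z ->
  pos (slide z) < pos (inl p : node N) -> pos (inl p : node N) < pos (inl q : node N) ->
  lab e z < lab f (inr p).
Proof.
move=> Fpq; have Fqp := mate_sym _ _ _ _ Fpq.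
have pN := ltn_ord p; have qN := ltn_ord q.
case: z => [i|j] /=; last by have := ltn_ord j; lia.
case Fi: (mate f (inl i)) => [//|r] _ /= rp pq.
have iN := ltn_ord i; have rN := ltn_ord r.
apply: leq_ltn_trans (lab_le _ _ Fi) _; rewrite -Fqp lab_mate.
by apply: lab_nested; rewrite ?Fi ?Fqp /=; lia.
Qed.

(** The comparison with the label of the propagating arc of [f] gives the upper
    bound at the new position, since that arc ends there. *)
Lemma lab_le_slide z : free z -> lab e z <= nabs (slide z).
Proof.
case: z => [i|j] /=; last by case: (lab_bounds _ e (inr j)).
case Fi: (mate f (inl i)) => [//|p] _ /=; apply: leq_trans (lab_le _ _ Fi) _.
by case: (lab_bounds _ f (inl i)) => _ _; rewrite Fi.
Qed.

Lemma odd_nabs_slide z : free z -> odd (nabs (slide z)) = odd (nabs z).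
Proof.
case: z => [i|//] /=; case Fi: (mate f (inl i)) => [//|p] _ /=.
by rewrite (through_parity _ f i p Fi).
Qed.

(** Sliding preserves which of two left nodes is smaller; at the ends of a
    propagating arc all four absolute values have the same parity. *)
Lemma odd_min_slide z : free z ->
  odd (minn (nabs (slide z)) (nabs (slide (mate e z)))) =
  odd (minn (nabs z) (nabs (mate e z))).
Proof.
move=> fz; have fm := free_mate z fz.
have oz := odd_nabs_slide z fz; have om := odd_nabs_slide _ fm.
have mono1 := slide_mono z (mate e z) fz fm.
have mono2 := slide_mono (mate e z) z fm fz.
have mixed i j : mate e (inl i) = inr j ->
    odd (nabs (inl i : node N)) = odd (nabs (inr j : node N)).
  by move=> /through_parity /= ->.
have slide_inl (i : 'I_N) : free (inl i) -> exists p, slide (inl i) = inl p.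
  by rewrite /=; case: (mate f (inl i)) => // p _; exists p.
have min_odd a b c d : odd a = odd c -> odd b = odd d -> odd c = odd d ->
    odd (minn a b) = odd (minn c d).
  by rewrite /minn => ac bd cd; do 2!case: ifP => _; congruence.
case Ez: (mate e z) => [j|j] in fm oz om mono1 mono2 *;
  case: z => [i|i] in fz Ez oz om mono1 mono2 *.
- have [p Ep] := slide_inl i fz; have [q Eq] := slide_inl j fm.
  by move: mono1 mono2 oz om; rewrite Ep Eq /= => m1 m2; rewrite /minn m1; case: ifP.
- by apply: min_odd => //; rewrite -(mixed j i) // (mate_sym _ _ _ _ Ez).
- by apply: min_odd => //; apply: mixed.
- by [].
Qed.

Lemma cofactor_okada : is_okada cofactor.
Proof.
apply/and3P; split.
- apply/forallP=> x; case: (nodeP x) => [z fz|p q Fpq].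
    have fm := free_mate z fz.
    have [-> _] := cofactor_slide z fz; have [-> _] := cofactor_slide _ fm.
    rewrite mateK eqxx andbT; apply/eqP=> /(slide_inj _ _ fm fz) E.
    by have := mate_neq _ e z; rewrite E eqxx.
  have [-> _] := cofactor_mirror p q Fpq.
  have [-> _] := cofactor_mirror q p (mate_sym _ _ _ _ Fpq).
  rewrite eqxx andbT; apply/eqP=> -[E].
  by have := mate_neq _ f (inr p); rewrite Fpq E eqxx.
- apply/forallP=> a; apply/forallP=> c; rewrite /node_lt; apply/negP=> /and3P[].
  case: (nodeP a) => [z fz|p q Fpq]; case: (nodeP c) => [w fw|r s Frs].
  + have fm := free_mate z fz; have fn := free_mate w fw.
    have [-> _] := cofactor_slide z fz; have [-> _] := cofactor_slide w fw.
    by rewrite !slide_mono //; apply: mate_noncrossing.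
  + have fm := free_mate z fz.
    have [-> _] := cofactor_slide z fz; have [-> _] := cofactor_mirror _ _ Frs.
    by move=> _; apply: mirror_encloses_no_slid.
  + have fn := free_mate w fw.
    have [-> _] := cofactor_slide w fw; have [-> _] := cofactor_mirror _ _ Fpq.
    by move=> pw wq _; apply: mirror_encloses_no_slid pw wq.
  + have [-> _] := cofactor_mirror _ _ Fpq; have [-> _] := cofactor_mirror _ _ Frs.
    have Fsr := mate_sym _ _ _ _ Frs; have Fqp := mate_sym _ _ _ _ Fpq.
    rewrite /= => pr rq qs.
    have pN := ltn_ord p; have qN := ltn_ord q; have rN := ltn_ord r; have sN := ltn_ord s.
    by apply: (mate_noncrossing _ f (inr s) (inr q)); rewrite ?Fsr ?Fqp /=; lia.
apply/and3P; split.
- apply/forallP=> x; case: (nodeP x) => [z fz|p q Fpq].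
    have [-> ->] := cofactor_slide z fz.
    by have [_ ->] := cofactor_slide _ (free_mate z fz); rewrite lab_mate.
  have [-> ->] := cofactor_mirror p q Fpq.
  have [_ ->] := cofactor_mirror q p (mate_sym _ _ _ _ Fpq).
  by rewrite -Fpq lab_mate.
- apply/forallP=> x; case: (nodeP x) => [z fz|p q Fpq] /=.
    have [-> ->] := cofactor_slide z fz; rewrite leq_min lab_le_slide //=.
    rewrite -{2}lab_mate lab_le_slide ?free_mate //=.
    by rewrite odd_min_slide //; case: (lab_bounds _ e z) => -> _ _ ->; rewrite eqxx.
  have [-> ->] := cofactor_mirror p q Fpq.
  by case: (lab_bounds _ f (inr p)); rewrite Fpq leq_min /= => -> -> -> ->; rewrite eqxx.
apply/forallP=> a; apply/forallP=> c; apply/implyP; rewrite /nested /node_lt => /and3P[].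
case: (nodeP a) => [z fz|p q Fpq]; case: (nodeP c) => [w fw|r s Frs].
- have fm := free_mate z fz; have fn := free_mate w fw.
  have [-> ->] := cofactor_slide z fz; have [-> ->] := cofactor_slide w fw.
  by rewrite !slide_mono //; apply: lab_nested.
- have [-> ->] := cofactor_slide z fz; have [-> ->] := cofactor_mirror _ _ Frs.
  move=> rz zm ms; case: (mirror_encloses_no_slid _ _ _ Frs fz rz).
  exact: ltn_trans zm ms.
- have [-> ->] := cofactor_slide w fw; have [-> ->] := cofactor_mirror _ _ Fpq.
  by move=> wp pq _; apply: lab_slid_lt_mirror Fpq fw wp pq.
- have [-> ->] := cofactor_mirror _ _ Fpq; have [-> ->] := cofactor_mirror _ _ Frs.
  have Fsr := mate_sym _ _ _ _ Frs; have Fqp := mate_sym _ _ _ _ Fpq.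
  rewrite /= => rp pq qs.
  have pN := ltn_ord p; have qN := ltn_ord q; have rN := ltn_ord r; have sN := ltn_ord s.
  rewrite -[lab f (inr p)]lab_mate -[lab f (inr r)]lab_mate Fpq Frs.
  by apply: lab_nested; rewrite ?Fsr ?Fqp /=; lia.
Qed.

Lemma mul_cofactor : diagram_mul f (Okada cofactor_okada) = e.
Proof.
(* The arcs that meet slid nodes determine the product, so the cofactor is
   abstracted to them; this also keeps it from being unfolded. *)
have : forall z, free z ->
    mate (Okada cofactor_okada) (slide z) = slide (mate e z) /\
    lab (Okada cofactor_okada) (slide z) = lab e z by exact: cofactor_slide.
move: (Okada cofactor_okada) => u uE.
suff arcs z : is_arc N (diagram_mul f u) z (mate e z) (lab e z).
  rewrite /diagram_mul in arcs *; case: (okada_diagram e) arcs => me le arcs.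
  by congr Diagram; apply/ffunP=> z; case: (arcs z).
have through i j : mate e (inl i) = inr j ->
    is_arc N (diagram_mul f u) (inl i) (inr j) (lab e (inl i)).
  move=> Eij; case Fi: (mate f (inl i)) => [k|p].
    by have [] := keep_arc _ _ Fi; rewrite Eij.
  have := uE (inl i); rewrite Eij /= Fi => /(_ isT)[up lp].
  rewrite -lp; apply: (mul_through_arc _ _ _ _ _ _ Fi up).
  by rewrite lp; apply: lab_le Fi.
case Ez: (mate e z) => [j|j]; case: z Ez => [i|i] Eij.
- case Fi: (mate f (inl i)) => [k|p].
    have [Eik ->] := keep_arc _ _ Fi; move: Eik; rewrite Eij => -[->].
    exact: mul_left_arc.
  have fi : free (inl i) by rewrite /= Fi.
  have := free_mate _ fi; rewrite Eij /=.
  case Fj: (mate f (inl j)) => [//|q] _.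
  have := uE _ fi; rewrite Eij /= Fi Fj => -[up lp]; rewrite -lp.
  apply: (mul_turn_back_arc _ _ _ _ _ _ _ Fi up Fj); rewrite lp.
    exact: lab_le Fi.
  by rewrite -lab_mate Eij; apply: lab_le Fj.
- rewrite -lab_mate Eij; apply/is_arcC/through/mate_sym/Eij.
- exact: through.
- have := uE (inr i) isT; rewrite Eij /= => -[ui <-].
  exact: mul_right_arc.
Qed.

End Cofactor.

Theorem theorem5p25 (N : nat) (e f : okada N) :
  okada_leR e f <-> half_le (left_half e) (left_half f).
Proof.
split=> [[u ->]|[keep le]].
  split=> i.
    move=> j; rewrite !ffunE; case Fi: (mate f (inl i)) => [k|//] [<-].
    by have [m _ l _] := mul_left_arc _ f u _ _ Fi; move: m l; rewrite !ffunE => -> ->.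
  by move=> _; rewrite !ffunE; apply: bigmin_le_idx.
have keep' i j : mate f (inl i) = inl j ->
    mate e (inl i) = inl j /\ lab e (inl i) = lab f (inl i).
  move=> Fi; have := keep i j; rewrite !ffunE Fi => /(_ erefl)[].
  by case: (mate e (inl i)) => // k [->].
have le' i p : mate f (inl i) = inr p -> lab e (inl i) <= lab f (inl i).
  by move=> Fi; have := le i; rewrite !ffunE Fi; apply.
by exists (Okada (cofactor_okada _ _ _ keep' le')); rewrite mul_cofactor.
Qed.
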